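(* Let $m$ be a positive even integer, $k$ a positive integer and $s$ an integer, and assume $v_{2}(k) \leq v_{2}(m)$ and $\gcd(2^{k}+2s+1,2^{m}-1)=1$. Then the polynomial $$x^{2^{k+m}+s2^{m+1}+2^{m}}+x^{2^{k+m}+s2^{m}+2^{m}+s}+x^{2^{k+m}+2^{m}+2s}+x^{s2^{m+1}+2^{m}+2^{k}}+x^{s2^{m+1}+2^{k}+1}+x^{s2^{m}+2^{m}+2^{k}+s}+x^{s2^{m}+2^{k}+s+1}+x^{2^{m}+2^{k}+2s}+x^{2^{k}+2s+1}$$ is a permutation polynomial over $\mathbb{F}_{2^{2m}}$.
   Context: $v_2(\cdot)$ denotes the 2-adic valuation. A polynomial $f$ is a permutation polynomial over $\mathbb{F}_{q}$ if $x\mapsto f(x)$ is a bijection of $\mathbb{F}_q$. Integer exponents are understood modulo $2^{2m}-1$, i.e. $x^{d}$ means $x^{d \bmod (2^{2m}-1)}$ (this makes sense also when $s$ is negative). *)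

(* Defs.v *)
From mathcomp Require Import all_boot all_order all_algebra all_field.
Set Implicit Arguments.
Unset Strict Implicit.
Unset Printing Implicit Defensive.
Import GRing.Theory.
Local Open Scope ring_scope.

Definition perm_poly (F : finFieldType) (f : {poly F}) : Prop :=
  bijective (fun x : F => f.[x]).

(* The modulus is positive for n > 0, so %% gives the representative in
   [0, 2 ^ n - 1) even when d is negative, and the absolute value only casts
   it to nat. *)
Definition red_exp (n : nat) (d : int) : nat :=
  `|(d %% (2%:Z ^+ n - 1))%Z|%N.

(* A multiple of 2 ^ n - 1 is reduced to the exponent 0, i.e. to the constant
   polynomial 1. *)
Definition mono (F : finFieldType) (n : nat) (d : int) : {poly F} :=
  'X^(red_exp n d).

Definition nonomial (F : finFieldType) (m k : nat) (s : int) : {poly F} :=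
  let X (d : int) : {poly F} := mono F (2 * m) d in
  let t (e : nat) : int := 2%:Z ^+ e in
    X (t (k + m)%N + s * t m.+1 + t m)
  + X (t (k + m)%N + s * t m + t m + s)
  + X (t (k + m)%N + t m + 2%:Z * s)
  + X (s * t m.+1 + t m + t k)
  + X (s * t m.+1 + t k + 1)
  + X (s * t m + t m + t k + s)
  + X (s * t m + t k + s + 1)
  + X (t m + t k + 2%:Z * s)
  + X (t k + 2%:Z * s + 1).

(* Main.v *)
(* Put q = 2^m, Q = 2^k and z = x^q.  For x <> 0 the polynomial evaluates to
   D(x) T(x), where D = z^(Q+1) + x^Q z + x^(Q+1) and
   T = x^(2s) + x^s z^s + z^(2s) is nonzero and fixed by the q-power map.
   For a primitive cube root of unity w (which lies in F_q, as m is even), let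
   L(x) = z + w x, an injective F_q-linear form.  Then D^q + w D is a constant
   times L^(Q+1) if k is odd, and times L^(qQ+1) if k is even.  If x and y have
   the same image and r = L(x)/L(y), then t = r^(q-1) satisfies t^(q+1) = 1 and
   t^(Q+1) = 1 (k odd) or t^(Q-1) = 1 (k even).  The valuation hypothesis gives
   t = 1, so r is in F_q, x = r y and r^(Q+2s+1) = 1, whence r = 1 by the gcd
   hypothesis. *)
Require Import Defs.
From mathcomp Require Import all_boot all_order all_algebra all_field.
From mathcomp Require Import all_fingroup all_solvable ring zify.
Set Implicit Arguments.
Unset Strict Implicit.
Unset Printing Implicit Defensive.
Import GRing.Theory.
Local Open Scope ring_scope.

Lemma expr_fix_muln (R : nzSemiRingType) (p a n : nat) (r : R) :
  r ^+ (p ^ a) = r -> r ^+ (p ^ (n * a)) = r.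
Proof.
move=> ra; elim: n => [|n IHn]; first by rewrite mul0n expn0 expr1.
by rewrite mulSn expnD exprM ra.
Qed.

(** Bezout: with [u * a = v * b + gcdn a b], raising [r = r ^+ (p ^ (v * b))] to the power
    [p ^ gcdn a b] gives [r ^+ (p ^ (u * a)) = r]. *)
Lemma expr_fix_gcdn (R : nzSemiRingType) (p a b : nat) (r : R) :
  (0 < a)%N -> r ^+ (p ^ a) = r -> r ^+ (p ^ b) = r ->
  r ^+ (p ^ gcdn a b) = r.
Proof.
move=> a_gt0 ra rb; have [u v Huv _] := egcdnP b a_gt0.
by rewrite -{1}(expr_fix_muln v rb) -exprM -expnD -Huv; apply: expr_fix_muln.
Qed.

(** Split the gcd into its 2-part and its odd part: the first divides [m] by the valuation bound,
    the second divides [2 * m] and is coprime to 2. *)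
Lemma dvdn_gcdn_double (k m : nat) :
  (0 < k)%N -> (0 < m)%N -> (logn 2 k <= logn 2 m)%N -> (gcdn k (2 * m) %| m)%N.
Proof.
move=> k_gt0 m_gt0 hv; set g := gcdn k (2 * m).
have g_gt0 : (0 < g)%N by rewrite gcdn_gt0 k_gt0.
have [g' co_g' Hg] := pfactor_coprime (isT : prime 2) g_gt0.
have lg : (logn 2 g <= logn 2 m)%N.
  by apply: leq_trans hv; apply: dvdn_leq_log => //; apply: dvdn_gcdl.
rewrite Hg Gauss_dvd; last by rewrite coprime_sym coprimeXl.
rewrite pfactor_dvdn // lg andbT.
rewrite -(@Gauss_dvdr g' 2 m); last by rewrite coprime_sym.
by apply: dvdn_trans (dvdn_gcdr k (2 * m)); rewrite [X in (_ %| X)%N]Hg dvdn_mulr.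
Qed.

(** Lets [ring] prove identities of characteristic 2: [c] is the explicit correction, half the
    difference of the two sides. *)
Lemma eq_mod2 (R : comNzRingType) (a b c : R) : 2 = 0 :> R -> a = b + 2 * c -> a = b.
Proof. by move=> -> ->; rewrite mul0r addr0. Qed.

(** Since 3 divides [4 ^ m - 1], Cauchy gives a unit of order 3; cancel [u - 1] in
    [u ^+ 3 - 1 = 0]. *)
Lemma exists_cube_root (F : finFieldType) (m : nat) :
  #|F| = (2 ^ (2 * m))%N -> (0 < m)%N -> exists w : F, w ^+ 2 = w + 1.
Proof.
move=> hF m_gt0; have c2 := card_finPcharP hF (isT : prime 2).
have d3 : (3 %| #|[set: {unit F}]|)%N.
  rewrite card_finField_unit hF expnM -subn1 -[X in (_ - X)%N](exp1n m).
  by rewrite subn_exp dvdn_mulr.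
have [u _ ou] := Cauchy (isT : prime 3) d3.
have u3 : (val u) ^+ 3 = 1 by rewrite -FinRing.val_unitX -ou expg_order.
have u1 : val u - 1 != 0.
  rewrite subr_eq0; apply/eqP => u1.
  suff: u = 1%g by move=> u1'; rewrite u1' order1 in ou.
  exact: val_inj.
exists (val u); apply: (mulfI u1); apply/eqP; rewrite -subr_eq0.
have e2 : 2 = 0 :> F by apply: pcharf0.
apply/eqP.
by apply: (eq_mod2 (c := 1 - val u ^+ 2) e2); ring: u3.
Qed.

(** Squaring swaps the two roots [w] and [w + 1]. *)
Lemma cube_root_exp (R : comNzRingType) (w : R) (n : nat) :
  2 = 0 :> R -> w ^+ 2 = w + 1 -> w ^+ (2 ^ n) = if odd n then w + 1 else w.
Proof.
move=> e2 hw; elim: n => [|n IHn]; first by rewrite expr1.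
rewrite expnS mulnC exprM IHn /=; case: (odd n) => //=.
by apply: (eq_mod2 (c := w + 1) e2); ring: hw.
Qed.

(* With b = a^q, A = a^Q and B = b^Q the left-hand side is D(a)^q + w D(a). *)
Lemma cube_root_factor (R : comNzRingType) (w a b A B : R) :
  2 = 0 :> R -> w ^+ 2 = w + 1 ->
  (A * a + B * a + B * b) + w * (B * b + A * b + A * a)
  = (w + 1) * ((B + (w + 1) * A) * (b + w * a)).
Proof.
by move=> e2 hw; apply: (eq_mod2 (c := - (w * B * a + (w + 1) * A * b + (2 * w + 1) * A * a)) e2); ring: hw.
Qed.

(** From [x ^+ q = w * x], a second q-th power gives [x = w ^+ 2 * x = (w + 1) * x], hence
    [w * x = 0]. *)
Lemma conj_plus_cube_root_eq0 (F : fieldType) (w x : F) (q : nat) :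
  2 = 0 :> F -> w ^+ 2 = w + 1 -> w ^+ q = w -> x ^+ q ^+ q = x ->
  x ^+ q + w * x = 0 -> x = 0.
Proof.
move=> e2 hw wq xqq h0.
have xq : x ^+ q = w * x.
  by apply: (eq_mod2 (c := - (w * x)) e2); rewrite -[LHS]subr0 -h0; ring.
have w0 : w != 0.
  by apply/eqP => w0; move: hw; rewrite w0 add0r expr0n => /esym/eqP; rewrite oner_eq0.
have x2 : x = (w + 1) * x.
  by rewrite -hw -{1}xqq xq exprMn wq xq expr2 mulrA.
have /eqP : w * x = 0 by apply: (addIr x); rewrite add0r {3}x2 mulrDl mul1r.
by rewrite mulf_eq0 (negPf w0) => /eqP.
Qed.

Lemma dvdz_mersenne (m n : nat) : (2%:Z ^+ m - 1 %| 2%:Z ^+ (m * n) - 1)%Z.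
Proof. by rewrite exprM subrX1 dvdz_mulr. Qed.

Lemma exprz_natE (p n : nat) : p%:Z ^+ n = (p ^ n)%N.
Proof. by rewrite -[RHS]natz natrX natz. Qed.

Lemma horner_mono (F : finFieldType) (n : nat) (d : int) (x : F) :
  #|F| = (2 ^ n)%N -> (0 < n)%N -> x != 0 -> (mono F n d).[x] = x ^ d.
Proof.
move=> hF n_gt0 x0; rewrite /mono /red_exp hornerXn.
set N := 2%:Z ^+ n - 1.
have N0 : N != 0.
  rewrite subr_eq0; apply/eqP => h; have := congr1 absz h.
  by rewrite abszX /= => n1; have := ltn_expl n (isT : 1 < 2)%N; rewrite n1 ltnNge n_gt0.
have xN : x ^ N = 1.
  by rewrite expfzDr // exprz_natE -exprnP -hF expf_card divff.
rewrite {2}(divz_eq d N) expfzDr // mulrC -exprz_exp [_ ^ N]exprzAC xN exp1rz mulr1.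
by rewrite -[in RHS](gez0_abs (modz_ge0 d N0)).
Qed.

(** Rules out the reduced exponent 0: it would make [2 ^ m - 1] divide [d], hence [e], and so equal
    1 by coprimality, against [1 < m]. *)
Lemma horner_mono0 (F : finFieldType) (m : nat) (d e c : int) :
  (1 < m)%N -> gcdz e (2%:Z ^+ m - 1) = 1 -> d = e + (2%:Z ^+ m - 1) * c ->
  (mono F (2 * m) d).[0] = 0.
Proof.
move=> m_gt1 hgcd hd; rewrite /mono /red_exp hornerXn expr0n.
case: eqP => //= /eqP; rewrite absz_eq0 => dN; exfalso.
have Md : (2%:Z ^+ m - 1 %| d)%Z.
  by apply: (dvdz_trans (dvdz_mersenne m 2)); rewrite mulnC; apply/dvdz_mod0P/eqP.
have Me : (2%:Z ^+ m - 1 %| e)%Z.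
  by rewrite hd rpredDr ?dvdz_mulr in Md.
have := dvdz_gcd (2%:Z ^+ m - 1) e (2%:Z ^+ m - 1); rewrite hgcd Me dvdzz /=.
rewrite dvdz1 exprz_natE.
have : (2 ^ 2 <= 2 ^ m)%N by rewrite leq_exp2l.
lia.
Qed.

Lemma horner_nonomial (F : finFieldType) (m k : nat) (s : int) (x : F) :
  #|F| = (2 ^ (2 * m))%N -> (1 < m)%N ->
  gcdz (2%:Z ^+ k + 2%:Z * s + 1) (2%:Z ^+ m - 1) = 1 ->
  let z := x ^+ (2 ^ m) in let A := x ^+ (2 ^ k) in let B := z ^+ (2 ^ k) in
  let a := x ^ s in let b := z ^ s in
  (nonomial F m k s).[x] =
    if x == 0 then 0 else (B * z + A * z + A * x) * (b ^+ 2 + a * b + a ^+ 2).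
Proof.
move=> hF m_gt1 hgcd /=; set z := x ^+ _.
have m_gt0 : (0 < 2 * m)%N by rewrite muln_gt0 /= ltnW.
(* All nine exponents have the form [i + 2 ^ m * j] with this same sum [i + j], to which they are
   congruent modulo [2 ^ m - 1]. *)
have Emono i j : i + j = 2%:Z ^+ k + 2%:Z * s + 1 ->
    (mono F (2 * m) (i + 2%:Z ^+ m * j)).[x] = if x == 0 then 0 else x ^ i * z ^ j.
  move=> ij; case: eqP => [->|/eqP x0].
    by apply: (horner_mono0 F (c := j) m_gt1 hgcd); rewrite -ij; ring.
  rewrite horner_mono // expfzDr // -exprz_exp.
  by rewrite exprz_natE -exprnP.
rewrite /nonomial !hornerD.
set Q := 2%:Z ^+ k; set t := 2%:Z ^+ m in Emono *.
have -> : 2%:Z ^+ (k + m) = Q * t by rewrite exprD.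
have -> : 2%:Z ^+ m.+1 = 2 * t by rewrite exprS.
rewrite (_ : Q + 2%:Z * s + 1 = Q + 2 * s + 1 + t * 0); last by ring.
rewrite (_ : Q * t + s * (2 * t) + t = 0 + t * (Q + 2 * s + 1)); last by ring.
rewrite (_ : Q * t + s * t + t + s = s + t * (Q + s + 1)); last by ring.
rewrite (_ : Q * t + t + 2%:Z * s = 2 * s + t * (Q + 1)); last by ring.
rewrite (_ : s * (2 * t) + t + Q = Q + t * (2 * s + 1)); last by ring.
rewrite (_ : s * (2 * t) + Q + 1 = Q + 1 + t * (2 * s)); last by ring.
rewrite (_ : s * t + t + Q + s = Q + s + t * (s + 1)); last by ring.
rewrite (_ : s * t + Q + s + 1 = Q + s + 1 + t * s); last by ring.
rewrite (_ : t + Q + 2%:Z * s = Q + 2 * s + t * 1); last by ring.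
rewrite !Emono -/Q; try ring.
case: eqP => [_|/eqP x0]; first by rewrite !addr0.
have z0 : z != 0 by rewrite expf_neq0.
have XQ y : y ^ Q = y ^+ (2 ^ k) by rewrite /Q exprz_natE.
have X2 (y : F) : y ^ (2 * s) = (y ^ s) ^+ 2 by rewrite mulrC -exprz_exp.
rewrite !expfzDr // !XQ !X2 !expr0z !expr1z.
ring.
Qed.

(** The condition involving [k] puts [t] in F_(2^m); there the norm condition reads [t ^+ 2 = 1], so
    [(t - 1) ^+ 2 = 0]. *)
Lemma norm1_eq1 (F : finFieldType) (m k : nat) (t : F) :
  #|F| = (2 ^ (2 * m))%N -> (0 < m)%N -> ~~ odd m -> (0 < k)%N ->
  (logn 2 k <= logn 2 m)%N -> t ^+ (2 ^ m) * t = 1 ->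
  t ^+ (2 ^ k) * (if odd k then t else t^-1) = 1 -> t = 1.
Proof.
move=> hF m_gt0 m_even k_gt0 hv tm tk; have e2 : 2 = 0 :> F.
  by apply: pcharf0; apply: card_finPcharP hF _.
have t0 : t != 0 by apply/eqP => t0; move/eqP: tm; rewrite t0 mulr0 eq_sym oner_eq0.
have t2m : t ^+ (2 ^ (2 * m)) = t by rewrite -hF expf_card.
have tqm : t ^+ (2 ^ m) = t.
  (* Some c with [logn 2 c <= logn 2 m], namely k or 2k, has t in F_(2^c); as
     gcd(c, 2m) divides m, t lies in F_(2^m). *)
  suff [c [c_gt0 cv tc]] : exists c, [/\ (0 < c)%N,
      (logn 2 c <= logn 2 m)%N & t ^+ (2 ^ c) = t].
    have /dvdnP[j ->] := dvdn_gcdn_double c_gt0 m_gt0 cv.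
    by apply: expr_fix_muln; apply: expr_fix_gcdn.
  move: tk; case: ifP => kodd tk.
    have tkV : t ^+ (2 ^ k) = t^-1 by apply: (mulIf t0); rewrite tk mulVf.
    (* For [k] odd, [2 * k] has valuation 1, which is within the bound because [m] is even. *)
    exists (2 * k)%N; split; first by rewrite muln_gt0.
      rewrite lognM // (@lognE 2 k) dvdn2 kodd /= andbF addn0 logn_prime //=.
      by rewrite -pfactor_dvdn // expn1 dvdn2.
    by rewrite mul2n -addnn expnD exprM tkV exprVn tkV invrK.
  exists k; split => //; apply: (mulIf (x := t^-1)); first by rewrite invr_eq0.
  by rewrite tk divff.
rewrite tqm in tm; apply/eqP; rewrite -subr_eq0 -sqrf_eq0; apply/eqP.
by apply: (eq_mod2 (c := 1 - t) e2); ring: tm.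
Qed.

Lemma expfz_coprime_eq1 (F : fieldType) (r : F) (d e : int) :
  r != 0 -> gcdz d e = 1 -> r ^ d = 1 -> r ^ e = 1 -> r = 1.
Proof.
move=> r0 de rd re; have [u [v uv]] := Bezoutz d e.
rewrite -[r]expr1z -de -uv expfzDr // mulrC [u * d]mulrC [v * e]mulrC.
by rewrite -!exprz_exp rd re !exp1rz mulr1.
Qed.

Theorem theorem1 (F : finFieldType) (m k : nat) (s : int)
  (hF : #|F| = (2 ^ (2 * m))%N)
  (hm : (0 < m)%N) (hmeven : ~~ odd m) (hk : (0 < k)%N)
  (hv : (logn 2 k <= logn 2 m)%N)
  (hgcd : gcdz (2%:Z ^+ k + 2%:Z * s + 1) (2%:Z ^+ m - 1) = 1) :
  perm_poly (nonomial F m k s).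
Proof.
have m_gt1 : (1 < m)%N by case: m hm hmeven {hF hv hgcd} => [|[]].
have c2 : 2%N \in [pchar F] by apply: card_finPcharP hF _.
have e2 : 2 = 0 :> F by apply: pcharf0.
have frobD n (a b : F) : (a + b) ^+ (2 ^ n) = a ^+ (2 ^ n) + b ^+ (2 ^ n).
  by apply: exprDn_pchar; rewrite pnatX pnatE // c2.
have [w hw] := exists_cube_root hF hm.
set q := (2 ^ m)%N; set Q := (2 ^ k)%N.
have frobq (a b : F) : (a + b) ^+ q = a ^+ q + b ^+ q by apply: frobD.
have frobQ (a b : F) : (a + b) ^+ Q = a ^+ Q + b ^+ Q by apply: frobD.
have xqq (x : F) : x ^+ q ^+ q = x.
  by rewrite -exprM -expnD addnn -mul2n -hF expf_card.
have wq : w ^+ q = w by rewrite cube_root_exp // (negPf hmeven).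
have wQ : w ^+ Q = if odd k then w + 1 else w by apply: cube_root_exp.
have w2q : (w + 1) ^+ q = w + 1 by rewrite frobq wq expr1n.
have hw2 : (w + 1) ^+ 2 = (w + 1) + 1.
  by apply: (eq_mod2 (c := w) e2); ring: hw.
have w2_neq0 : w + 1 != 0.
  rewrite -hw sqrf_eq0; apply/eqP => w0; move: hw.
  by rewrite w0 add0r expr0n => /esym/eqP; rewrite oner_eq0.
pose L (x : F) := x ^+ q + w * x.
have L_neq0 x : x != 0 -> L x != 0.
  by apply: contra_neq; apply: conj_plus_cube_root_eq0 (xqq x).
pose D (x : F) := (x ^+ q) ^+ Q * x ^+ q + x ^+ Q * x ^+ q + x ^+ Q * x.
pose T (x : F) := ((x ^+ q) ^ s) ^+ 2 + x ^ s * (x ^+ q) ^ s + (x ^ s) ^+ 2.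
pose P (x : F) := (x ^+ q) ^+ Q + (w + 1) * x ^+ Q.
have DE x : (D x) ^+ q + w * D x = (w + 1) * (P x * L x).
  rewrite -cube_root_factor // /D !frobq !exprMn xqq.
  by rewrite ![_ ^+ Q ^+ q]exprAC xqq addrAC.
(* For [k] odd the Q-th power sends [w] to [w + 1]; for [k] even it fixes [w], and [w * (w + 1) = 1]
   is used. *)
have PE x : P x = if odd k then L x ^+ Q else (w + 1) * (L x ^+ q) ^+ Q.
  rewrite /P /L !frobq !exprMn xqq wq !frobQ !exprMn wQ.
  by case: (odd k) => //; apply: (eq_mod2 (c := - w * x ^+ q ^+ Q) e2); ring: hw.
have expsq (x : F) : (x ^ s) ^+ q = (x ^+ q) ^ s by rewrite exprnP exprzAC.
have Tq x : (T x) ^+ q = T x.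
  by rewrite /T !frobq (exprMn q (x ^ s)) ![_ ^+ 2 ^+ q]exprAC !expsq xqq; ring.
have T_neq0 x : x != 0 -> T x != 0.
  move=> x0; pose a := x ^ s; have a0 : a != 0 by apply: expfz_neq0.
  (* [T x] is the norm form [b ^+ 2 + a * b + a ^+ 2] with [b = a ^+ q], which splits over the two
     cube roots [w] and [w + 1]. *)
  have -> : T x = L a * (a ^+ q + (w + 1) * a).
    rewrite /T /L /a expsq.
    set b := (x ^+ q) ^ s.
    by apply: (eq_mod2 (c := - w * (x ^ s * b + (x ^ s) ^+ 2)) e2); ring: hw.
  rewrite mulf_neq0 ?L_neq0 //; apply: contra_neq a0.
  exact: conj_plus_cube_root_eq0 (xqq a).
have P_neq0 x : x != 0 -> P x != 0.
  by move=> x0; rewrite PE; case: ifP; rewrite ?mulf_neq0 ?expf_neq0 ?L_neq0.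
have D_neq0 x : x != 0 -> D x != 0.
  move=> x0; apply/eqP => D0; have /esym/eqP := DE x.
  rewrite D0 expr0n expn_eq0 /= mulr0 addr0.
  by apply/negP; rewrite !mulf_neq0 ?P_neq0 ?L_neq0.
suff inj x y : x != 0 -> y != 0 -> D x * T x = D y * T y -> x = y.
  apply: injF_bij => x y /=; rewrite !horner_nonomial //.
  rewrite -/q -/Q -/(D x) -/(D y) -/(T x) -/(T y).
  have [->|x0] := eqVneq x 0; have [->|y0] := eqVneq y 0 => //; last exact: inj.
    by move/esym/eqP; rewrite mulf_eq0 (negPf (D_neq0 y y0)) (negPf (T_neq0 y y0)).
  by move/eqP; rewrite mulf_eq0 (negPf (D_neq0 x x0)) (negPf (T_neq0 x x0)).
move=> x0 y0 hxy.
(* As [T] is fixed by the q-th power, apply [v ^+ q + w * v] to the common value [v] of [D * T] and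
   use [DE]. *)
have hPL : P x * L x * T x = P y * L y * T y.
  apply: (mulfI w2_neq0); rewrite mulrA -DE [RHS]mulrA -DE.
  rewrite !mulrDl -!mulrA hxy; congr (_ + _).
  by rewrite -{1}(Tq x) -{1}(Tq y) -!exprMn hxy.
have [r r0 Lx] : exists2 r, r != 0 & L x = r * L y.
  by exists (L x / L y); rewrite ?divfK ?mulf_neq0 ?invr_eq0 ?L_neq0.
pose rho := if odd k then r ^+ Q else (r ^+ q) ^+ Q.
have Px : P x = rho * P y.
  by rewrite !PE Lx !exprMn /rho; case: (odd k); ring.
have rhoT : rho * r * T x = T y.
  have PLy : P y * L y != 0 by rewrite mulf_neq0 ?P_neq0 ?L_neq0.
  by apply: (mulfI PLy); rewrite -hPL Px Lx; ring.
have rhoq : (rho * r) ^+ q = rho * r.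
  by apply: (mulIf (T_neq0 x x0)); rewrite -{1}(Tq x) -exprMn rhoT Tq.
(* Here [t = r ^+ q / r]; [rhoq] becomes [t ^+ Q * t = 1] for [k] odd and [t ^+ Q = t] for [k]
   even. *)
have rq : r ^+ q = r.
  apply: (divIf r0); rewrite divff //.
  apply: (norm1_eq1 hF hm hmeven hk hv); rewrite -/q -/Q expr_div_n.
    by rewrite xqq mulrA divfK ?expf_neq0 // divff.
  have rQ0 : r ^+ Q != 0 by rewrite expf_neq0.
  have rq0 : r ^+ q != 0 by rewrite expf_neq0.
  have rqQ : r ^+ q ^+ Q = r ^+ Q ^+ q by rewrite exprAC.
  move: rhoq; rewrite /rho exprMn; case: (odd k) => rr.
    by rewrite rqQ mulrACA rr -invfM divff // mulf_neq0.
  rewrite rqQ xqq in rr.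
  by rewrite rqQ invf_div mulrACA -rr -invfM [r ^+ Q * _]mulrC divff // mulf_neq0.
have xy : x = r * y.
  (* Since [r ^+ q = r], [L (x + r * y) = L x + r * L y = 2 * L x = 0]. *)
  have d0 : x + r * y = 0.
    apply: (conj_plus_cube_root_eq0 e2 hw wq (xqq _)).
    rewrite frobq exprMn rq -[RHS](mul0r (L x)) -e2 /L.
    have: x ^+ q + w * x = r * (y ^+ q + w * y) by [].
    move=> h; rewrite mulr_natl mulr2n {2}h; ring.
  by apply: (eq_mod2 (c := - (r * y)) e2); rewrite -[LHS]subr0 -d0; ring.
(* Replacing [y] by [r * y] scales [D] by [r ^+ Q * r] and [T] by [(r ^ s) ^+ 2]; cancel the nonzero
   common value. *)
have rd : r ^ (2%:Z ^+ k + 2%:Z * s + 1) = 1.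
  rewrite !expfzDr // exprz_natE -exprnP expr1z mulrC [2%:Z * s]mulrC -exprz_exp.
  have DTy : D y * T y != 0 by rewrite mulf_neq0 ?D_neq0 ?T_neq0.
  apply: (mulIf DTy); rewrite mul1r -[RHS]hxy xy /D /T !exprMn !rq !expfzMl.
  rewrite !exprMn -!exprnP; ring.
have re : r ^ (2%:Z ^+ m - 1) = 1.
  by rewrite expfzDr // exprz_natE -exprnP rq divff.
by rewrite xy (expfz_coprime_eq1 r0 hgcd rd re) mul1r.
Qed.
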